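(* Every $\mathfrak{a}$-compact space is $\mathfrak{a}$-sequentially compact. That is, if $(X,\tau,\mathfrak{a})$ is an $\mathfrak{a}$-space and $X$ is $\mathfrak{a}$-compact, then every sequence in $X$ has an $\mathfrak{a}$-convergent subsequence.
   Context: An aura topological space (or $\mathfrak{a}$-space) $(X,\tau,\mathfrak{a})$ is a topological space $(X,\tau)$ together with a function $\mathfrak{a}:X\to\tau$ (a scope function) such that $x\in\mathfrak{a}(x)$ for every $x\in X$. A subset $A\subseteq X$ is $\mathfrak{a}$-open if $\mathfrak{a}(x)\subseteq A$ for every $x\in A$; the collection $\tau_{\mathfrak{a}}$ of all $\mathfrak{a}$-open sets is a topology on $X$ with $\tau_{\mathfrak{a}}\subseteq\tau$. The space $X$ is $\mathfrak{a}$-compact if every cover of $X$ by members of $\tau_{\mathfrak{a}}$ has a finite subcover. A sequence $(x_n)$ in $X$ $\mathfrak{a}$-converges to $x\in X$ if for every $U\in\tau_{\mathfrak{a}}$ with $x\in U$ there exists $N\in\mathbb{N}$ such that $x_n\in U$ for all $n\geq N$; it is $\mathfrak{a}$-convergent if it $\mathfrak{a}$-converges to some point of $X$. The space is $\mathfrak{a}$-sequentially compact if every sequence in $X$ has an $\mathfrak{a}$-convergent subsequence. *)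

(* Defs.v *)
From HB Require Import structures.
From mathcomp Require Import all_boot all_order all_algebra finmap.
From mathcomp Require Import mathcomp_extra boolp classical_sets functions.
From mathcomp Require Import cardinality filter topology.

Set Implicit Arguments.
Unset Strict Implicit.
Unset Printing Implicit Defensive.

Local Open Scope classical_set_scope.

Record scope_function (X : topologicalType) := ScopeFunction {
  scope_fun :> X -> set X ;
  scope_open : forall x, open (scope_fun x) ;
  scope_mem : forall x, scope_fun x x }.

Section AuraTopology.
Context {X : topologicalType} (a : scope_function X).

Definition aura_open (A : set X) : Prop := forall x, A x -> a x `<=` A.

Lemma aura_openT : aura_open setT.
Proof. by []. Qed.

Lemma aura_openI : setI_closed aura_open.
Proof. by move=> A B oA oB x [/oA aA /oB aB] y ay; split; [exact: aA|exact: aB]. Qed.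

Lemma aura_open_bigU (I : Type) (f : I -> set X) :
  (forall i, aura_open (f i)) -> aura_open (\bigcup_i f i).
Proof. by move=> of_ x [i _ fx] y /(of_ i x fx) fy; exists i. Qed.

Lemma aura_open_open A : aura_open A -> open A.
Proof.
move=> oA; suff -> : A = \bigcup_(x in A) a x.
  by apply: bigcup_open => x _; exact: scope_open.
by apply/seteqP; split=> [x Ax|y [x Ax]]; [exists x => //; exact: scope_mem|exact: oA].
Qed.

End AuraTopology.

(* A copy of X, indexed by the scope function, whose topology is tau_a instead
   of tau. *)
Definition aura_space (X : topologicalType) (a : scope_function X) : Type := X.

HB.instance Definition _ (X : topologicalType) (a : scope_function X) :=
  Choice.on (aura_space a).
HB.instance Definition _ (X : topologicalType) (a : scope_function X) :=
  isOpenTopological.Build (aura_space a)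
    (@aura_openT X a) (@aura_openI X a) (@aura_open_bigU X a).

Section AuraCompactness.
Context {X : topologicalType} (a : scope_function X).

Lemma open_auraE : @open (aura_space a) = aura_open a.
Proof. by []. Qed.

Definition aura_compact : Prop := cover_compact [set: aura_space a].

Definition aura_cvg (s : nat -> X) (x : X) : Prop :=
  (s : nat -> aura_space a) n @[n --> \oo] --> (x : aura_space a).

Lemma aura_cvgP s x : aura_cvg s x <->
  forall U, aura_open a U -> U x ->
    exists N, forall n, (N <= n)%N -> U (s n).
Proof.
split=> [sx U oU Ux|sx V [U [oU Ux UV]]].
  have [N _ sN] := sx U (open_nbhs_nbhs (conj oU Ux : open_nbhs (x : aura_space a) U)).
  by exists N.
by have [N sN] := sx U oU Ux; exists N => // n /sN Un; exact: UV.
Qed.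

Definition aura_convergent (s : nat -> X) : Prop := exists x, aura_cvg s x.

Definition aura_sequentially_compact : Prop :=
  forall s : nat -> X, exists phi : nat -> nat,
    {homo phi : m n / (m < n)%N} /\ aura_convergent (s \o phi).

End AuraCompactness.

(* Main.v *)
Require Import Defs.
From mathcomp Require Import all_boot topology.
From mathcomp Require Import finmap boolp classical_sets.

(** Aura-open sets are stable under arbitrary intersections, so every point has
    a smallest aura-open neighbourhood.  Finitely many of these cover a compact
    space, so a sequence visits one of them infinitely often; the corresponding
    subsequence converges to the centre of that neighbourhood. *)

Local Open Scope classical_set_scope.

Definition aura_hull (X : topologicalType) (a : scope_function X) (x : X) :
  set X := [set y | forall U, aura_open a U -> U x -> U y].

Lemma aura_open_hull (X : topologicalType) (a : scope_function X) (x : X) :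
  aura_open a (aura_hull X a x).
Proof. by move=> y xy z ayz U oU Ux; exact: (oU y (xy U oU Ux)). Qed.

Lemma aura_hull_refl (X : topologicalType) (a : scope_function X) (x : X) :
  aura_hull X a x x.
Proof. by []. Qed.

Lemma frequently_subsequence (P : set nat) :
  (forall n, exists2 m, n <= m & P m) ->
  exists2 phi : nat -> nat, {homo phi : m n / m < n} & forall n, P (phi n).
Proof.
move=> freqP.
have /choice [g gP] : forall n, exists m, n <= m /\ P m.
  by move=> n; have [m nm Pm] := freqP n; exists m.
(* Applying [g] after the successor forces a strict increase; starting at [g 0] rather than 0 puts
   the first value in [P] too. *)
exists (fun n => iter n (g \o succn) (g 0)) => [|[|n]]; last 2 first.
- exact: (gP _).2.
- exact: (gP _).2.
by apply: homo_ltn => [|n]; [exact: ltn_trans | exact: (gP _).1].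
Qed.

Lemma aura_compact_frequently_hull (X : topologicalType) (a : scope_function X)
    (s : nat -> X) : aura_compact a ->
  exists x, forall n, exists2 m, n <= m & aura_hull X a x (s m).
Proof.
move=> cptX.
have [|x _|D _ coverD] := cptX X setT (aura_hull X a).
- by move=> x _; exact: aura_open_hull.
- by exists x => //; exact: aura_hull_refl.
apply: contrapT => /forallNP notfreq.
have /choice [N NP] : forall x, exists n,
    forall m, n <= m -> ~ aura_hull X a x (s m).
  move=> x; have /existsNP [n nP] := notfreq x.
  by exists n => m nm xm; apply: nP; exists m.
(* At the largest threshold over the finite subcover, the sequence would avoid every hull of a
   subcover of the whole space. *)
have [x Dx] := coverD (s (\max_(x <- D) N x)) I.
by apply: NP; exact: leq_bigmax_seq.
Qed.

Theorem theorem3p22 (X : topologicalType) (a : scope_function X) :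
  aura_compact a -> aura_sequentially_compact a.
Proof.
move=> cptX s.
have [x freqx] := aura_compact_frequently_hull X a s cptX.
have [phi phi_incr phix] := frequently_subsequence _ freqx.
exists phi; split=> //; exists x; apply/aura_cvgP => U oU Ux.
(* The threshold 0 serves every [U]: the whole subsequence lies in the hull of [x], hence in each
   aura-open set containing [x]. *)
by exists 0 => n _; exact: phix.
Qed.
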